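(* Let $\mathcal{C}$ be a binary formally self-dual code of length $n$, and let $\Lambda_{\mathrm{A}}(\mathcal{C})$ be its Construction A lattice. Then for every $\tau>0$, $$\bigl[\Xi_{\Lambda_{\mathrm{A}}(\mathcal{C})}(\tau)\bigr]^{-1}=\frac{W_{\mathcal{C}}\bigl(\sqrt{1+t(\tau)},\sqrt{1-t(\tau)}\bigr)}{2^{n/2}},$$ where $t(\tau)=\vartheta_4^2(i\tau)/\vartheta_3^2(i\tau)$ satisfies $0<t(\tau)<1$. Moreover, defining $f_{\mathcal{C}}(t)=W_{\mathcal{C}}(\sqrt{1+t},\sqrt{1-t})$ for $0<t<1$, maximizing the secrecy function $\Xi_{\Lambda_{\mathrm{A}}(\mathcal{C})}(\tau)$ over $\tau>0$ is equivalent to determining the minimum of $f_{\mathcal{C}}(t)$ over $t\in(0,1)$ (via the correspondence $t=t(\tau)$).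
   Context: For a binary linear code $\mathcal{C}\subseteq\mathbb{F}_2^n$, $W_{\mathcal{C}}(x,y)=\sum_{w=0}^n A_w x^{n-w}y^w$ with $A_w$ the number of codewords of Hamming weight $w$; $\mathcal{C}$ is formally self-dual if $W_{\mathcal{C}}=W_{\mathcal{C}^\perp}$ (so $\dim\mathcal{C}=n/2$). Construction A: $\Lambda_{\mathrm{A}}(\mathcal{C})=\frac{1}{\sqrt2}(\phi(\mathcal{C})+2\mathbb{Z}^n)$, $\phi$ the natural embedding $\mathbb{F}_2^n\to\mathbb{R}^n$. Theta series: $\Theta_\Lambda(z)=\sum_{\boldsymbol{\lambda}\in\Lambda}e^{i\pi z\|\boldsymbol{\lambda}\|^2}$, $\operatorname{Im}z>0$. For a lattice of volume $\nu^n$ (volume $=|\det|$ of a generator matrix), the secrecy function is $\Xi_\Lambda(\tau)=\Theta_{\nu\mathbb{Z}^n}(i\tau)/\Theta_\Lambda(i\tau)$, $\tau>0$. Jacobi theta functions: $\vartheta_3(z)=\sum_{m\in\mathbb{Z}}e^{i\pi z m^2}$, $\vartheta_4(z)=\sum_{m\in\mathbb{Z}}(-1)^m e^{i\pi z m^2}$. *)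

(* Defs.v *)
From HB Require Import structures.
From mathcomp Require Import all_boot all_order all_algebra.
From mathcomp Require Import all_classical all_reals all_analysis.
Set Implicit Arguments. Unset Strict Implicit. Unset Printing Implicit Defensive.
Import Order.TTheory GRing.Theory Num.Theory.
Local Open Scope classical_set_scope.
Local Open Scope ring_scope.

Section Defs.
Variable R : realType.

Definition F2vec (n : nat) := 'rV['F_2]_n.

Definition is_linear_code n (C : {set 'rV['F_2]_n}) : Prop :=
  (0 \in C) /\ (forall x y, x \in C -> y \in C -> x + y \in C).

Definition hwt n (c : 'rV['F_2]_n) : nat := #|[set i : 'I_n | c 0 i != 0]|.

Definition dual_code n (C : {set 'rV['F_2]_n}) : {set 'rV['F_2]_n} :=
  [set y : 'rV['F_2]_n | [forall x in C, \sum_(i < n) x 0 i * y 0 i == 0]].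

Definition wdist n (C : {set 'rV['F_2]_n}) (w : nat) : nat :=
  #|[set c in C | hwt c == w]|.

Definition weight_enum n (C : {set 'rV['F_2]_n}) (x y : R) : R :=
  \sum_(w < n.+1) (wdist C w)%:R * x ^+ (n - w) * y ^+ w.

(* formally self-dual: W_C = W_{C^perp} as polynomials, i.e. equal weight
   distributions *)
Definition formally_self_dual n (C : {set 'rV['F_2]_n}) : Prop :=
  forall w : nat, wdist C w = wdist (dual_code C) w.

Definition phi n (c : 'rV['F_2]_n) : 'rV[R]_n :=
  map_mx (fun b : 'F_2 => (nat_of_ord b)%:R) c.

Definition intvec n (z : 'rV[int]_n) : 'rV[R]_n := map_mx (fun k => k%:~R) z.

Definition constructionA n (C : {set 'rV['F_2]_n}) : set 'rV[R]_n :=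
  [set v | exists c, c \in C /\ exists z : 'rV[int]_n,
      v = (Num.sqrt 2)^-1 *: (phi c + 2 *: intvec z)].

Definition scaledZn n (nu : R) : set 'rV[R]_n :=
  [set v | exists z : 'rV[int]_n, v = nu *: intvec z].

Definition generator_matrix n (B : 'M[R]_n) (L : set 'rV[R]_n) : Prop :=
  B \in unitmx /\ L = [set v | exists z : 'rV[int]_n, v = intvec z *m B].

(* volume = |det| of a generator matrix (independent of the choice) *)
Definition lattice_volume n (L : set 'rV[R]_n) : R :=
  xget 0 [set a | exists B : 'M[R]_n, generator_matrix B L /\ a = `|\det B|].

Definition sqnorm n (v : 'rV[R]_n) : R := \sum_(i < n) v 0 i ^+ 2.

(* theta series on the imaginary axis: Theta_L(i tau) = sum_{v in L} e^{-pi tau |v|^2} *)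
Definition theta_lattice n (L : set 'rV[R]_n) (tau : R) : \bar R :=
  (\esum_(v in L) (expR (- pi * tau * sqnorm v))%:E)%E.

(* secrecy function Xi_L(tau) = Theta_{nu Z^n}(i tau) / Theta_L(i tau),
   where vol L = nu^n *)
Definition secrecy n (L : set 'rV[R]_n) (tau : R) : R :=
  let nu := lattice_volume L `^ (n%:R)^-1 in
  fine (theta_lattice (@scaledZn n nu) tau) / fine (theta_lattice L tau).

(* sum over m in Z, taken as the limit of the symmetric partial sums
   sum_{m=-N}^{N} (absolutely convergent for tau > 0) *)
Definition sumZ (g : int -> R) : R :=
  limn (fun N : nat => \sum_(i < (N + N).+1) g (i%:Z - N%:Z)).

Definition theta3 (tau : R) : R :=
  sumZ (fun m => expR (- pi * tau * (m%:~R) ^+ 2)).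

Definition theta4 (tau : R) : R :=
  sumZ (fun m => (-1) ^ m * expR (- pi * tau * (m%:~R) ^+ 2)).

Definition tfun (tau : R) : R := theta4 tau ^+ 2 / theta3 tau ^+ 2.

Definition fC n (C : {set 'rV['F_2]_n}) (t : R) : R :=
  weight_enum C (Num.sqrt (1 + t)) (Num.sqrt (1 - t)).

End Defs.

(* Main.v *)
(* Write th3 and th2 for the Jacobi functions theta_3 and theta_2 on the imaginary axis.
   Splitting a codeword coordinatewise, the Construction A lattice has theta series
   W_C (th3 (2 tau)) (th2 (2 tau)), and the duplication formulas
     theta_3(tau)^2 +- theta_4(tau)^2 = 2 th3(2 tau)^2, resp. 2 th2(2 tau)^2
   turn the two arguments into th3(tau) sqrt((1 +- t)/2).  Formal self-duality enters only
   through dim C = n/2, which makes the lattice unimodular.  All duplication formulas reduce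
   to the bijection (a, b) |-> (a + b, a - b) between Z^2 and the pairs of equal parity, so
   they are identities between sums of nonnegative terms.

   The equivalence of the two optimisation problems only needs t to map (0, +oo) onto (0, 1),
   for which continuity and the duplication formulas suffice (no modular transformation).  By
   duplication the ratio rho = th2/th3 satisfies rho(2 tau) <= rho(tau)^2 and
   1 - rho(tau) <= (1 - rho(2 tau))^2, so it tends to 0 along 2^k and to 1 along 2^-k, and
   the intermediate value theorem applies. *)

Require Import Defs.
From HB Require Import structures.
From mathcomp Require Import all_boot all_order all_algebra.
From mathcomp Require Import fingroup perm mxabelem.
From mathcomp Require Import all_classical all_reals all_analysis.
From mathcomp Require Import zify ring lra.
Import Order.TTheory GRing.Theory Num.Theory.
Import numFieldNormedType.Exports.
Local Open Scope classical_set_scope.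
Local Open Scope ring_scope.

(** * Sums of nonnegative families *)

(** [esum] takes values in the extended reals, so equality with a real number records convergence
    and value at once, and nonnegative families can be rearranged freely. *)
Definition has_sum {R : realType} {T : choiceType} (S : set T) (f : T -> R) (x : R) :=
  (\esum_(i in S) (f i)%:E = x%:E)%E.

Lemma has_sum_unique {R : realType} {T : choiceType} {S : set T} {f : T -> R} {x y} :
  has_sum S f x -> has_sum S f y -> x = y.
Proof. by rewrite /has_sum => -> []. Qed.

Lemma has_sum_eq {R : realType} {T : choiceType} {S : set T} {f g : T -> R} {x} :
  (forall i, S i -> f i = g i) -> has_sum S f x -> has_sum S g x.
Proof. by move=> fg; rewrite /has_sum => <-; apply: eq_esum => i Si; rewrite fg. Qed.

Lemma has_sum_reindex {R : realType} {T T' : choiceType} {P : set T} {Q : set T'}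
    (e : T -> T') {f : T' -> R} {x : R} :
  set_bij P Q e -> has_sum P (f \o e) x -> has_sum Q f x.
Proof. by move=> be; rewrite /has_sum (reindex_esum P Q e). Qed.

Lemma has_sumZ {R : realType} {T : choiceType} {S : set T} {f : T -> R} {c x : R} :
  0 <= c -> (forall i, 0 <= f i) ->
  has_sum S f x -> has_sum S (fun i => c * f i) (c * x).
Proof.
move=> c0 f0; rewrite /has_sum EFinM => <-; rewrite /esum -ereal_supZl//.
- congr ereal_sup; apply/seteqP; split=> [_ [X SX <-]|_ [_ [X SX <-] <-]].
    exists (\sum_(i \in X) (f i)%:E)%E; first by exists X.
    by rewrite ge0_mule_fsumr// => i; rewrite lee_fin.
  by exists X => //; rewrite ge0_mule_fsumr// => i; rewrite lee_fin.
- by apply/set0P; exists 0%E; exists set0; [exact: fsets_set0|rewrite fsbig_set0].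
Qed.

(** Tonelli: the double sum is an iterated one, and each inner sum pulls out its constant factor. *)
Lemma has_sum_setX {R : realType} {T T' : choiceType} {S : set T} {S' : set T'}
    {f : T -> R} {g : T' -> R} {x y : R} :
  (forall i, 0 <= f i) -> (forall j, 0 <= g j) -> 0 <= y ->
  has_sum S f x -> has_sum S' g y ->
  has_sum (S `*` S') (fun k => f k.1 * g k.2) (x * y).
Proof.
move=> f0 g0 y0 fx gy.
have -> : S `*` S' = S `*`` (fun=> S') by apply/seteqP; split.
rewrite /has_sum -(@esum_esum R T T' S (fun=> S') (fun i j => (f i * g j)%:E)); last first.
  by move=> i j _ _; rewrite lee_fin mulr_ge0.
transitivity (\esum_(i in S) (y * f i)%:E)%E.
  apply: eq_esum => i _; rewrite mulrC.
  exact: (has_sumZ (f0 i) g0 gy).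
by rewrite [x * y]mulrC; exact: (has_sumZ y0 f0 fx).
Qed.

Lemma has_sumU {R : realType} {T : choiceType} {A B : set T} {f : T -> R} {x y : R} :
  (forall i, 0 <= f i) -> A `&` B = set0 ->
  has_sum A f x -> has_sum B f y -> has_sum (A `|` B) f (x + y).
Proof.
move=> f0 AB; rewrite /has_sum EFinD => <- <-.
rewrite (esumID A); last by move=> i _; rewrite lee_fin.
congr (_ + _)%E; congr (esum _ _).
  by apply/seteqP; split=> i /=; [case|move=> Ai; split=> //; left].
apply/seteqP; split=> i /=; first by case=> -[].
move=> Bi; split; first by right.
by move=> Ai; have : (A `&` B) i by []; rewrite AB.
Qed.

Lemma has_sum_le {R : realType} {T : choiceType} {S : set T} {f g : T -> R} {x y : R} :
  (forall i, S i -> f i <= g i) -> has_sum S f x -> has_sum S g y -> x <= y.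
Proof.
move=> fg; rewrite /has_sum => fx gy; rewrite -lee_fin -fx -gy.
by apply: le_esum => i Si; rewrite lee_fin fg.
Qed.

Lemma has_sum_ge0 {R : realType} {T : choiceType} {S : set T} {f : T -> R} {x : R} :
  (forall i, 0 <= f i) -> has_sum S f x -> 0 <= x.
Proof.
move=> f0; rewrite /has_sum => fx; rewrite -lee_fin -fx.
by apply: esum_ge0 => i Si; rewrite lee_fin.
Qed.

Lemma has_sumD {R : realType} {T : choiceType} {S : set T} {f g : T -> R} {x y : R} :
  (forall i, 0 <= f i) -> (forall i, 0 <= g i) ->
  has_sum S f x -> has_sum S g y -> has_sum S (fun i => f i + g i) (x + y).
Proof.
move=> f0 g0; rewrite /has_sum EFinD => <- <-.
rewrite -esumD; [|by move=> i _; rewrite lee_fin..].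
by apply: eq_esum => i _; rewrite EFinD.
Qed.

(** The sums over [A] and over the rest of [B] are nonnegative with a finite total, so neither is
    infinite. *)
Lemma has_sum_subset {R : realType} {T : choiceType} {A B : set T} {f : T -> R} {x : R} :
  (forall i, 0 <= f i) -> A `<=` B -> has_sum B f x -> exists y, has_sum A f y.
Proof.
move=> f0 AB; rewrite /has_sum (esumID A); last by move=> i _; rewrite lee_fin.
rewrite setIC setIidl// => E.
have h0 : (0 <= \esum_(i in B `&` ~` A) (f i)%:E)%E.
  by apply: esum_ge0 => i _; rewrite lee_fin.
have h1 : (0 <= \esum_(i in A) (f i)%:E)%E.
  by apply: esum_ge0 => i _; rewrite lee_fin.
case: (esum A _) E h1 => [r| |] //; first by exists r.
by case: (esum _ _) h0.
Qed.

Lemma has_sum_term {R : realType} {T : choiceType} {S : set T} {f : T -> R} {x : R} j :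
  (forall i, 0 <= f i) -> S j -> has_sum S f x -> f j <= x.
Proof.
move=> f0 Sj; rewrite /has_sum => fx; rewrite -lee_fin -fx; apply: esum_ge.
exists [set j]; last by rewrite fsbig_set1.
by split; [exact: finite_set1|move=> _ ->].
Qed.

Lemma has_sum_set1 {R : realType} {T : choiceType} (j : T) (f : T -> R) :
  0 <= f j -> has_sum [set j] f (f j).
Proof. by move=> f0; rewrite /has_sum esum_set1// lee_fin. Qed.

Lemma has_sum_mask {R : realType} {T : choiceType} {S : set T} (f : T -> R) (p : pred T) {x : R} :
  (forall i, 0 <= f i) ->
  has_sum (S `&` [set` p]) f x -> has_sum S (fun i => (p i)%:R * f i) x.
Proof.
move=> f0; rewrite /has_sum esum_mkcondr => <-; apply: eq_esum => i _.
by rewrite mem_setE; case: ifP; rewrite /in_mem/= => ->; rewrite ?mul1r ?mul0r.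
Qed.

Lemma has_sum_bigU {R : realType} {T : choiceType} {I : finType} (D : {set I})
    (F : I -> set T) {f : T -> R} (x : I -> R) :
  (forall i, 0 <= f i) -> (forall i j t, F i t -> F j t -> i = j) ->
  (forall i, i \in D -> has_sum (F i) f (x i)) ->
  has_sum [set t | exists2 i, i \in D & F i t] f (\sum_(i in D) x i).
Proof.
move=> f0 Finj FX.
have -> : [set t | exists2 i, i \in D & F i t] =
  [set t | exists2 i, i \in enum D & F i t].
  by apply/seteqP; split=> t [i iD Fit]; exists i => //; move: iD; rewrite mem_enum.
rewrite -big_enum/=.
have {FX} : forall i, i \in enum D -> has_sum (F i) f (x i).
  by move=> i; rewrite mem_enum; exact: FX.
elim: (enum D) (enum_uniq D) => [|i s IH] /=.
  move=> _ _; rewrite big_nil /has_sum.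
  by rewrite (_ : mkset _ = set0) ?esum_set0//; apply/seteqP; split=> t //= [].
move=> /andP[is_ us] FX; rewrite big_cons.
rewrite (_ : mkset _ = F i `|` [set t | exists2 i, i \in s & F i t]).
  apply: has_sumU => //.
  - apply/seteqP; split=> t //= -[Fit [j js Fjt]].
    by move: is_; rewrite (Finj _ _ _ Fit Fjt) js.
  - by apply: FX; rewrite mem_head.
  - by apply: IH => // j js; apply: FX; rewrite inE js orbT.
apply/seteqP; split=> t /=.
  by move=> [j]; rewrite inE => /orP[/eqP->|js] Ft; [left|right; exists j].
move=> [Ft|[j js Ft]]; first by exists i => //; rewrite mem_head.
by exists j => //; rewrite inE js orbT.
Qed.

Lemma has_sum_sub_le {R : realType} {T : choiceType} {A B : set T} {f : T -> R} {x y : R} :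
  (forall i, 0 <= f i) -> A `<=` B -> has_sum A f x -> has_sum B f y -> x <= y.
Proof.
move=> f0 AB; rewrite /has_sum => fx fy; rewrite -lee_fin -fx -fy.
rewrite [leRHS](esumID A); last by move=> i _; rewrite lee_fin.
rewrite setIC setIidl// leeDl//; apply: esum_ge0 => i _; by rewrite lee_fin.
Qed.

Lemma has_sum_fin {R : realType} {T : finType} (f : T -> R) :
  (forall i, 0 <= f i) -> has_sum [set: T] f (\sum_i f i).
Proof.
move=> f0.
have := @has_sum_bigU R T T [set: T]%SET (fun i => [set i]) f f f0.
rewrite (_ : mkset _ = [set: T]); last by apply/seteqP; split=> // t _; exists t => //; rewrite inE.
rewrite (eq_bigl xpredT); last by move=> i; rewrite inE.
by apply=> [i j t -> ->|i _] //; exact: has_sum_set1.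
Qed.

Lemma has_sum_fine {R : realType} {T : choiceType} {S : set T} {f : T -> R} :
  (exists x, has_sum S f x) -> has_sum S f (fine (\esum_(i in S) (f i)%:E)%E).
Proof. by rewrite /has_sum => -[x ->]. Qed.

Lemma has_sum_dominated {R : realType} {T : choiceType} {S : set T} {f g : T -> R} {y : R} :
  (forall i, 0 <= f i <= g i) -> has_sum S g y -> exists x, has_sum S f x.
Proof.
move=> fg; rewrite /has_sum => gy.
have h0 : (0 <= \esum_(i in S) (f i)%:E)%E.
  by apply: esum_ge0 => i _; rewrite lee_fin; case/andP: (fg i).
have h1 : (\esum_(i in S) (f i)%:E <= y%:E)%E.
  by rewrite -gy; apply: le_esum => i _; rewrite lee_fin; case/andP: (fg i).
by case: (esum S _) h0 h1 => [r| |] //; exists r.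
Qed.

Lemma has_sum_geometric {R : realType} {q : R} : 0 <= q < 1 ->
  has_sum [set: nat] (fun k => q ^+ k) (1 - q)^-1.
Proof.
move=> /andP[q0 q1]; rewrite /has_sum -nneseries_esumT; last first.
  by move=> n; rewrite lee_fin exprn_ge0.
apply/cvg_lim => //; under eq_fun do rewrite sumEFin.
apply: cvg_EFin; first exact: nearW.
have := @cvg_geometric_series R 1 q; rewrite ger0_norm// q1 mul1r => /(_ isT).
apply: cvg_trans; apply: near_eq_cvg; apply: nearW => n.
by apply: eq_bigr => i _; rewrite /geometric/= mul1r.
Qed.

(** * Symmetric partial sums over the integers *)

Lemma has_sum_window {R : realType} (g : int -> R) (N : nat) :
  (forall m, 0 <= g m) ->
  has_sum [set m : int | - N%:Z <= m <= N%:Z] g (\sum_(i < (N + N).+1) g (i%:Z - N%:Z)).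
Proof.
move=> g0; apply: (has_sum_reindex (fun i : 'I_(N + N).+1 => i%:Z - N%:Z)); last first.
  exact: (@has_sum_fin R 'I_(N + N).+1 (fun i => g (i%:Z - N%:Z))).
split.
- by move=> i _ /=; have := ltn_ord i; lia.
- by move=> i j _ _ h; apply: val_inj => /=; lia.
- move=> m /= hm; have km : (absz (m + N%:Z)%R < (N + N).+1)%N by lia.
  by exists (Ordinal km) => //=; lia.
Qed.

(** This connects [has_sum] with the limit in [sumZ]. A finite set whose sum exceeds [x - e] lies in
    every large enough window, and the window sums are bounded by [x]. *)
Lemma cvg_sumZ {R : realType} {g : int -> R} {x : R} : (forall m, 0 <= g m) ->
  has_sum [set: int] g x ->
  (fun N : nat => \sum_(i < (N + N).+1) g (i%:Z - N%:Z)) @ \oo --> x.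
Proof.
move=> g0 gx; apply/cvgrPdist_lt => e e0.
have [_ [X [finX _] <-]] : exists2 y, [set (\sum_(i \in A) (g i)%:E)%E | A in fsets [set: int]] y
    & ((x - e)%:E < y)%E.
  by apply: ereal_sup_gt; rewrite -[ereal_sup _]/(esum _ _) gx lte_fin ltrBlDr ltrDl.
rewrite -esum_fset//; last by move=> i _; rewrite lee_fin.
have [y hy] := has_sum_subset g0 (@subsetT _ X) gx.
rewrite (hy : esum _ _ = _) lte_fin => xy.
exists (\max_(m <- finmap.enum_fset (fset_set X)) `|m|%N)%N => //= N /= XN.
have hN := has_sum_window g N g0.
have h1 := has_sum_sub_le g0 (@subsetT _ _) hN gx.
have XS : X `<=` [set m : int | - N%:Z <= m <= N%:Z].
  move=> m Xm /=; have : (`|m| <= N)%N.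
    apply: leq_trans XN; apply: (@leq_bigmax_seq _ _ xpredT absz) => //.
    by rewrite in_fset_set// inE.
  by lia.
have h2 := has_sum_sub_le g0 XS hy hN.
by rewrite ger0_norm ?subr_ge0//; lra.
Qed.

(** * Theta functions and their duplication formulas *)

Definition gauss {R : realType} (tau x : R) : R := expR (- pi * tau * x ^+ 2).

Lemma gauss_gt0 {R : realType} (tau x : R) : 0 < gauss tau x.
Proof. exact: expR_gt0. Qed.

Lemma gauss_ge0 {R : realType} (tau x : R) : 0 <= gauss tau x.
Proof. exact: expR_ge0. Qed.

#[local] Hint Resolve gauss_ge0 gauss_gt0 : core.

Lemma setT_int : [set: int] = range Posz `|` range Negz.
Proof. by apply/seteqP; split=> // -[k|k] _; [left|right]; exists k. Qed.

Lemma gauss_le_geometric {R : realType} {tau x : R} (k : nat) : 0 < tau ->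
  k%:R <= x ^+ 2 -> gauss tau x <= expR (- pi * tau) ^+ k.
Proof.
move=> t0 kx; rewrite /gauss -expRM_natl ler_expR mulrC.
by rewrite ler_wnM2r// mulNr oppr_le0 mulr_ge0// ?pi_ge0// ltW.
Qed.

(** On each half of the integers the terms are dominated by a geometric series of ratio exp(- pi
    tau), because k <= k^2 and k <= (k + 1)^2. *)
Lemma gauss_summable {R : realType} {tau : R} : 0 < tau ->
  exists x, has_sum [set: int] (fun m => gauss tau m%:~R) x.
Proof.
move=> t0.
have q01 : 0 <= expR (- pi * tau) < 1.
  by rewrite expR_ge0/= expR_lt1 mulNr oppr_lt0 mulr_gt0// pi_gt0.
have H (e : nat -> int) : injective e -> (forall k, k%:R <= ((e k)%:~R : R) ^+ 2) ->
    exists x, has_sum (range e) (fun m => gauss tau m%:~R) x.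
  move=> ei ek.
  have [x hx] : exists x, has_sum [set: nat] ((fun m : int => gauss tau m%:~R) \o e) x.
    apply: has_sum_dominated (has_sum_geometric q01) => k /=.
    by rewrite gauss_ge0/=; apply: gauss_le_geometric.
  exists x; apply: has_sum_reindex hx.
  by apply: inj_bij => i j _ _; exact: ei.
have nat_sq (k : nat) : (k%:R : R) <= k%:R ^+ 2.
  by rewrite -natrX ler_nat; case: k => // k; rewrite expnS expn1 leq_pmulr.
have [|k|x hx] := H Posz; first by move=> ? ? [].
  by rewrite -pmulrn; exact: nat_sq.
have [|k|y hy] := H Negz; first by move=> ? ? [].
  rewrite NegzE rmorphN/= sqrrN -pmulrn (le_trans (nat_sq k))//.
  by rewrite lerXn2r ?nnegrE// ?ler_nat.
exists (x + y); rewrite setT_int; apply: has_sumU => //.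
by apply/seteqP; split=> _ // [[i _ <-] [j _]].
Qed.

(** The offset [(p, q)] selects the class of pairs whose sum has the parity of [p + q]. Inverting
    the map needs only that this sum determines [a] by halving. *)
Lemma set_bij_pair (p q : int) :
  set_bij [set: int * int] [set mn | exists j, mn.1 + mn.2 = p + q + 2 * j]
    (fun ab : int * int => (ab.1 + ab.2 + p, ab.1 - ab.2 + q)).
Proof.
split.
- by move=> [a b] _ /=; exists a; lia.
- move=> [a b] [a' b'] _ _ /= [h1 h2].
  by congr (_, _); lia.
- move=> [m n] /= [j h]; exists (j, m - p - j) => //=.
  by congr (_, _); lia.
Qed.

Lemma set_bij_mul2 (p : int) :
  set_bij [set: int] [set m | exists j, m = p + 2 * j] (fun a : int => 2 * a + p).
Proof.
split.
- by move=> a _ /=; exists a; lia.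
- by move=> a a' _ _ /= h; lia.
- by move=> m /= [j h]; exists j => //; lia.
Qed.

Lemma even_or_odd (m : int) : (exists j, m = 0 + 2 * j) \/ (exists j, m = 1 + 2 * j).
Proof.
have [h|h] : m = 2 * (m %/ 2)%Z \/ m = 2 * (m %/ 2)%Z + 1 by lia.
  by left; exists (m %/ 2)%Z; lia.
by right; exists (m %/ 2)%Z; lia.
Qed.

Lemma gauss_scale4 {R : realType} (tau x : R) : gauss (4 * tau) x = gauss tau (2 * x).
Proof. by rewrite /gauss; congr expR; ring. Qed.

(** The parallelogram law in the exponent. *)
Lemma gaussM {R : realType} (tau x y : R) :
  gauss (2 * tau) x * gauss (2 * tau) y = gauss tau (x + y) * gauss tau (x - y).
Proof. by rewrite /gauss -!expRD; congr expR; ring. Qed.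

(** At i tau, the shift 0 gives theta_3 and the shift 1/2 gives theta_2. One definition lets both
    share the squaring and continuity arguments. [th3_sum] and [th2_sum] show that [fine] discards
    no infinite value for [0 < tau]. *)
Definition shifted_theta {R : realType} (c tau : R) : R :=
  fine (\esum_(m in [set: int]) (gauss tau (m%:~R + c))%:E)%E.

Local Notation th3 := (shifted_theta 0).
Local Notation th2 := (shifted_theta 2^-1).

Lemma th3_sum {R : realType} {tau : R} : 0 < tau ->
  has_sum [set: int] (fun m => gauss tau (m%:~R + 0)) (th3 tau).
Proof.
move=> t0; apply: has_sum_fine; have [x hx] := gauss_summable t0.
by exists x; apply: has_sum_eq hx => i _; rewrite addr0.
Qed.

Lemma odd_reindex {R : realType} (tau x : R) :
  has_sum [set m | exists j, m = 1 + 2 * j] (fun m : int => gauss tau m%:~R) x <->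
  has_sum [set: int] (fun m => gauss (4 * tau) (m%:~R + 2^-1)) x.
Proof.
rewrite /has_sum (reindex_esum _ _ _ _ (set_bij_mul2 1)).
suff -> : (fun i : int => (gauss tau (2 * i + 1)%:~R)%:E) =
    (fun i : int => (gauss (4 * tau) (i%:~R + 2^-1))%:E) by [].
apply/funext => i; rewrite gauss_scale4; congr (gauss _ _)%:E.
by rewrite intrD intrM; field.
Qed.

(** Finiteness is inherited from the odd terms of the theta_3 series at tau / 4. *)
Lemma th2_sum {R : realType} {tau : R} : 0 < tau ->
  has_sum [set: int] (fun m => gauss tau (m%:~R + 2^-1)) (th2 tau).
Proof.
move=> t0; apply: has_sum_fine; have t4 : 0 < tau / 4 by rewrite divr_gt0.
have [x hx] := gauss_summable t4.
have [||y] := @has_sum_subset _ _ [set m | exists j, m = 1 + 2 * j] _ _ _ _ _ hx => //.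
by move=> /odd_reindex; rewrite mulrC divfK//; exists y.
Qed.

Lemma th3_odd {R : realType} {tau : R} : 0 < tau ->
  has_sum [set m | exists j, m = 1 + 2 * j] (fun m : int => gauss tau m%:~R) (th2 (4 * tau)).
Proof. by move=> t0; apply/odd_reindex/th2_sum; rewrite mulr_gt0. Qed.

Lemma th3_even {R : realType} {tau : R} : 0 < tau ->
  has_sum [set m | exists j, m = 0 + 2 * j] (fun m : int => gauss tau m%:~R) (th3 (4 * tau)).
Proof.
move=> t0; apply: (has_sum_reindex _ (set_bij_mul2 0)).
have t4 : 0 < 4 * tau by rewrite mulr_gt0.
apply: has_sum_eq (th3_sum t4) => i _ /=.
by rewrite gauss_scale4 intrD intrM !addr0.
Qed.

(** The square is a sum over pairs (m, n), split by the parity of m + n. With m = a + b + p and n =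
    a - b + q, each class factors into a sum over a and a sum over b. The representatives of the
    even and odd class stay free so that the shifts (p + q) / 2 and (p - q) / 2 can be chosen to
    land on 0 or 1/2. *)
Lemma shifted_theta_sqr {R : realType} {tau c : R} (p q p' q' : int) (x y x' y' : R) :
  0 < tau ->
  (forall tau' : R, 0 < tau' ->
    has_sum [set: int] (fun m => gauss tau' (m%:~R + c)) (shifted_theta c tau')) ->
  (exists j, p + q = 0 + 2 * j) -> (exists j, p' + q' = 1 + 2 * j) ->
  0 <= y -> 0 <= y' ->
  has_sum [set: int] (fun m => gauss (4 * tau) (m%:~R + c + (p + q)%:~R / 2)) x ->
  has_sum [set: int] (fun m => gauss (4 * tau) (m%:~R + (p - q)%:~R / 2)) y ->
  has_sum [set: int] (fun m => gauss (4 * tau) (m%:~R + c + (p' + q')%:~R / 2)) x' ->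
  has_sum [set: int] (fun m => gauss (4 * tau) (m%:~R + (p' - q')%:~R / 2)) y' ->
  shifted_theta c (2 * tau) ^+ 2 = x * y + x' * y'.
Proof.
move=> t0 hc [k hk] [l hl] y0 y0' hx hy hx' hy'.
have t2 : 0 < 2 * tau by rewrite mulr_gt0.
have h0 := has_sum_ge0 (fun i => gauss_ge0 _ _) (hc _ t2).
have := has_sum_setX (fun i => gauss_ge0 _ _) (fun i => gauss_ge0 _ _) h0 (hc _ t2) (hc _ t2).
rewrite -expr2; set f := (X in has_sum _ X) => hsqr.
apply: (has_sum_unique hsqr).
have f0 i : 0 <= f i by apply: mulr_ge0; exact: gauss_ge0.
have key (r s : int) (u v : R) : 0 <= v ->
  has_sum [set: int] (fun m => gauss (4 * tau) (m%:~R + c + (r + s)%:~R / 2)) u ->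
  has_sum [set: int] (fun m => gauss (4 * tau) (m%:~R + (r - s)%:~R / 2)) v ->
  has_sum [set mn | exists j, mn.1 + mn.2 = r + s + 2 * j] f (u * v).
  move=> v0 hu hv; apply: (has_sum_reindex _ (set_bij_pair r s)).
  rewrite (_ : [set: int * int] = [set: int] `*` [set: int]); last by apply/seteqP; split.
  have := has_sum_setX (fun i => gauss_ge0 _ _) (fun i => gauss_ge0 _ _) v0 hu hv.
  apply: has_sum_eq => -[a b] _ /=; rewrite /f/= gaussM.
  rewrite !gauss_scale4.
  by congr (gauss _ _ * gauss _ _); rewrite !(intrD, intrB, intrM); field.
have := has_sumU f0 _ (key _ _ _ _ y0 hx hy) (key _ _ _ _ y0' hx' hy').
rewrite (_ : _ `|` _ = [set: int] `*` [set: int]); last first.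
  apply/seteqP; split=> // -[m n] _ /=.
  have [[j hj]|[j hj]] := even_or_odd (m + n); [left|right].
    by exists (j - k); lia.
  by exists (j - l); lia.
apply; apply/seteqP; split=> -[m n] //= [[i hi] [j hj]]; lia.
Qed.

Lemma th3_sqr {R : realType} {tau : R} : 0 < tau ->
  th3 (2 * tau) ^+ 2 = th3 (4 * tau) ^+ 2 + th2 (4 * tau) ^+ 2.
Proof.
move=> t0; have t4 : 0 < 4 * tau by rewrite mulr_gt0.
have hA := th3_sum t4; have hB := th2_sum t4.
have A0 := has_sum_ge0 (fun i => gauss_ge0 _ _) hA.
have B0 := has_sum_ge0 (fun i => gauss_ge0 _ _) hB.
rewrite [th3 (4 * _) ^+ _]expr2 [th2 (4 * _) ^+ _]expr2.
apply: (shifted_theta_sqr 0 0 1 0 _ _ _ _ t0) => //.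
- by move=> ?; exact: th3_sum.
- by exists 0.
- by exists 0.
- by apply: has_sum_eq hA => i _; rewrite !(addr0, subr0, mul0r, mul1r).
- by apply: has_sum_eq hA => i _; rewrite !(addr0, subr0, mul0r, mul1r).
- by apply: has_sum_eq hB => i _; rewrite !(addr0, subr0, mul0r, mul1r).
- by apply: has_sum_eq hB => i _; rewrite !(addr0, subr0, mul0r, mul1r).
Qed.

Lemma th2_sqr {R : realType} {tau : R} : 0 < tau ->
  th2 (2 * tau) ^+ 2 = 2 * (th3 (4 * tau) * th2 (4 * tau)).
Proof.
move=> t0; have t4 : 0 < 4 * tau by rewrite mulr_gt0.
have hA := th3_sum t4; have hB := th2_sum t4.
have A0 := has_sum_ge0 (fun i => gauss_ge0 _ _) hA.
have B0 := has_sum_ge0 (fun i => gauss_ge0 _ _) hB.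
rewrite [RHS](_ : _ = th2 (4 * tau) * th3 (4 * tau) + th3 (4 * tau) * th2 (4 * tau)); last by ring.
(* The odd representative (0, -1) cancels the shift 1/2 in the first factor and creates it in the
   second. *)
apply: (shifted_theta_sqr 0 0 0 (-1) _ _ _ _ t0) => //.
- by move=> ?; exact: th2_sum.
- by exists 0.
- by exists (-1).
- by apply: has_sum_eq hB => i _; rewrite !(addr0, subr0, mul0r, mul1r).
- by apply: has_sum_eq hA => i _; rewrite !(addr0, subr0, mul0r, mul1r).
- by apply: has_sum_eq hA => i _; rewrite !(add0r, mulrN1z, mulN1r, addrK, addr0).
- by apply: has_sum_eq hB => i _; rewrite !(sub0r, opprK, mul1r).
Qed.

Lemma theta3E {R : realType} {tau : R} : 0 < tau -> theta3 tau = th3 tau.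
Proof.
move=> t0; apply/cvg_lim => //; apply: (@cvg_sumZ R (fun m => gauss tau m%:~R)) => //.
by apply: has_sum_eq (th3_sum t0) => i _; rewrite addr0.
Qed.

(** The sign is 1 on even and -1 on odd integers, so theta_4 is a difference of two nonnegative
    sums. Indicator masks extend both to all integers, so that their window sums can be subtracted
    term by term. *)
Lemma theta4E {R : realType} {tau : R} : 0 < tau -> theta4 tau = th3 (4 * tau) - th2 (4 * tau).
Proof.
move=> t0; apply/cvg_lim => //.
have mask (r : int) x :
    has_sum [set m | exists j, m = r + 2 * j] (fun m : int => gauss tau m%:~R) x ->
    has_sum [set: int] (fun m => `[< exists j, m = r + 2 * j >]%:R * gauss tau m%:~R) x.
  move=> h; apply: has_sum_mask => //.
  apply: etrans h; congr (esum _ _); apply/seteqP; split=> m /=; rewrite /in_mem/=.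
    by case=> _ /asboolP.
  by move=> h; split=> //; apply/asboolP.
have g0 (p : int -> bool) m : 0 <= (p m)%:R * gauss tau m%:~R.
  by apply: mulr_ge0; [exact: ler0n|exact: gauss_ge0].
have h0 := cvg_sumZ (g0 _) (mask _ _ (th3_even t0)).
have h1 := cvg_sumZ (g0 _) (mask _ _ (th3_odd t0)).
apply: cvg_trans (cvgB h0 h1); apply: near_eq_cvg; apply: nearW => N.
rewrite fctE -sumrB; apply: eq_bigr => i _.
set m := (i%:Z - N%:Z); rewrite -mulrBl; congr (_ * _).
have [[j hj]|[j hj]] := even_or_odd m.
- have -> : `[< exists k, m = 0 + 2 * k >] by apply/asboolP; exists j.
  have -> : `[< exists k, m = 1 + 2 * k >] = false by apply/asboolP => -[k hk]; lia.
  by rewrite subr0 hj add0r -exprz_exp -(exprnP _ 2) sqrrN expr1n exp1rz.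
- have -> : `[< exists k, m = 1 + 2 * k >] by apply/asboolP; exists j.
  have -> : `[< exists k, m = 0 + 2 * k >] = false by apply/asboolP => -[k hk]; lia.
  rewrite sub0r hj expfzDr ?oppr_eq0 ?oner_eq0// -exprz_exp -(exprnP _ 2) sqrrN expr1n exp1rz.
  by rewrite mulr1.
Qed.

(** * The ratio of theta_2 to theta_3 and its range *)

Section Nome.
Context {R : realType}.
Implicit Types tau s : R.

Lemma th3_double {tau} : 0 < tau -> th3 tau ^+ 2 = th3 (2 * tau) ^+ 2 + th2 (2 * tau) ^+ 2.
Proof.
move=> t0; have t2 : 0 < tau / 2 by rewrite divr_gt0.
have := th3_sqr t2; rewrite (_ : 2 * (tau / 2) = tau); last by field.
by rewrite (_ : 4 * (tau / 2) = 2 * tau); last by field.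
Qed.

Lemma th2_double {tau} : 0 < tau -> th2 tau ^+ 2 = 2 * (th3 (2 * tau) * th2 (2 * tau)).
Proof.
move=> t0; have t2 : 0 < tau / 2 by rewrite divr_gt0.
have := th2_sqr t2; rewrite (_ : 2 * (tau / 2) = tau); last by field.
by rewrite (_ : 4 * (tau / 2) = 2 * tau); last by field.
Qed.

Lemma th3_ge1 {tau} : 0 < tau -> 1 <= th3 tau.
Proof.
move=> t0; have := has_sum_term (0 : int) (fun i => gauss_ge0 _ _) I (th3_sum t0).
by rewrite /gauss addr0 expr0n mulr0 expR0.
Qed.

Lemma th3_gt0 {tau} : 0 < tau -> 0 < th3 tau.
Proof. by move=> /th3_ge1; exact: lt_le_trans. Qed.

Lemma th2_gt0 {tau} : 0 < tau -> 0 < th2 tau.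
Proof.
move=> t0; have := has_sum_term (0 : int) (fun i => gauss_ge0 _ _) I (th2_sum t0).
by apply: lt_le_trans; exact: gauss_gt0.
Qed.

(** The square of a half-integer is at least 1/4, so each term loses a factor of at least exp(pi s /
    4) >= 1 + pi s / 4. *)
Lemma th2_decay {tau s} : 0 < tau -> 0 <= s -> (1 + pi * s / 4) * th2 (tau + s) <= th2 tau.
Proof.
move=> t0 s0; have c0 : 0 <= 1 + pi * s / 4 by rewrite addr_ge0// divr_ge0// mulr_ge0// pi_ge0.
apply: has_sum_le (has_sumZ c0 _ (th2_sum _)) (th2_sum t0) => //; last by rewrite ltr_wpDr.
move=> m _; set x := m%:~R + 2^-1.
have x2 : 4^-1 <= x ^+ 2.
  have : (1 : R) <= (2 * m + 1)%:~R ^+ 2.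
    by rewrite -rmorphXn/= -[1]/(1%:~R) ler_int; nia.
  by rewrite intrD intrM /x; nra.
rewrite /gauss.
have -> : - pi * (tau + s) * x ^+ 2 = - (pi * s * x ^+ 2) + - pi * tau * x ^+ 2 by ring.
rewrite expRD mulrA -[leRHS]mul1r ler_wpM2r// ?expR_ge0// expRN.
rewrite ler_pdivrMr ?expR_gt0// mul1r.
by apply: le_trans (expR_ge1Dx _); rewrite lerD2l ler_wpM2l// mulr_ge0// pi_ge0.
Qed.

(** By duplication, theta_3^2 - theta_2^2 at tau is the square of theta_3 - theta_2 at 2 tau. *)
Lemma th2_lt_th3_of_double {tau} : 0 < tau -> th2 (2 * tau) < th3 (2 * tau) -> th2 tau < th3 tau.
Proof.
move=> t0 lt2; have := th3_double t0; have := th2_double t0.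
have := th3_gt0 t0; have := th2_gt0 t0.
by move: (th3 _) (th2 _) (th3 _) (th2 _) lt2 => a b c d; nra.
Qed.

(** At 2^k tau with k large, [th2_decay] gives theta_2 < 1 <= theta_3; the inequality then descends
    to tau by k halvings. *)
Lemma th2_lt_th3 {tau} : 0 < tau -> th2 tau < th3 tau.
Proof.
move=> t0; have tk k : 0 < 2 ^+ k * tau by rewrite mulr_gt0// exprn_gt0.
have back k : th2 (2 ^+ k * tau) < th3 (2 ^+ k * tau) -> th2 tau < th3 tau.
  elim: k => [|k IH]; first by rewrite expr0 mul1r.
  by rewrite exprS -mulrA => /(th2_lt_th3_of_double (tk k)).
set c := pi * tau / 4.
have c0 : 0 < c by rewrite divr_gt0// mulr_gt0// pi_gt0.
(* Decay over the distance (2^k - 1) tau divides theta_2 by at least 1 + (2^k - 1) c, and k <= 2^k -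
   1, so k c > [th2 tau] suffices. *)
have [k hk] : exists k : nat, th2 tau / c < k%:R.
  by exists (Num.bound (th2 tau / c)); apply: archi_boundP; rewrite divr_ge0// ltW// th2_gt0.
apply: (back k); apply: lt_le_trans (th3_ge1 (tk k)).
have k2 : k%:R <= 2 ^+ k - 1 :> R.
  by rewrite lerBrDr -natrX natr1 ler_nat ltn_expl.
have := @th2_decay tau ((2 ^+ k - 1) * tau) t0.
rewrite (_ : tau + _ = 2 ^+ k * tau); last by ring.
have -> : 0 <= (2 ^+ k - 1) * tau by apply: mulr_ge0; [exact: le_trans k2|exact: ltW].
move=> /(_ isT); set d := pi * _ / 4.
have -> : d = (2 ^+ k - 1) * c by rewrite /d /c; ring.
move: hk; rewrite ltr_pdivrMr// => hk hd.
have := th2_gt0 (tk k); set b := th2 (_ * _) in hd *; set a := th2 tau in hk hd.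
move=> b0; rewrite ltNge; apply/negP => b1.
have : k%:R * c <= (2 ^+ k - 1) * c by rewrite ler_wpM2r// ltW.
have a0 : 0 < a by exact: th2_gt0.
move=> kK; have : 1 * (1 + (2 ^+ k - 1) * c) <= b * (1 + (2 ^+ k - 1) * c).
  by rewrite ler_wpM2r//; lra.
lra.
Qed.

Definition theta_ratio tau : R := th2 tau / th3 tau.

Lemma theta_ratio_itv {tau} : 0 < tau -> 0 < theta_ratio tau < 1.
Proof.
move=> t0; have A0 := th3_gt0 t0; have B0 := th2_gt0 t0.
by rewrite /theta_ratio divr_gt0//= ltr_pdivrMr// mul1r th2_lt_th3.
Qed.

(** The quotient of the two duplication formulas; it is the Landen transformation for the elliptic
    modulus [theta_ratio tau ^+ 2]. *)
Lemma theta_ratio_double {tau} : 0 < tau ->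
  theta_ratio tau ^+ 2 * (1 + theta_ratio (2 * tau) ^+ 2) = 2 * theta_ratio (2 * tau).
Proof.
move=> t0; have t2 : 0 < 2 * tau by rewrite mulr_gt0.
rewrite /theta_ratio expr_div_n th2_double//.
have := th3_double t0; have := th3_gt0 t0; have := th3_gt0 t2.
move: (th3 _) (th2 _) (th3 _) => a b c a0 c0 h.
have [an cn] : a != 0 /\ c != 0 by rewrite !gt_eqF.
by rewrite h; field; rewrite ?cn ?andbT ?andTb -h expf_neq0.
Qed.

(** Squaring at each step gives at least geometric decay, u_k <= u_0^(k+1). It serves both for the
    ratio along 2^k and for its distance to 1 along 2^-k. *)
Lemma quadratic_decay (u : nat -> R) : (forall k, 0 <= u k < 1) ->
  (forall k, u k.+1 <= u k ^+ 2) -> forall e : R, 0 < e -> exists k, u k < e.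
Proof.
move=> u01 uS e e0.
have uk k : u k <= u 0%N ^+ k.+1.
  elim: k => [|k IH]; first by rewrite expr1.
  have /andP[u0 u1] := u01 0%N; have /andP[k0 k1] := u01 k.
  apply: le_trans (uS k) _; apply: (@le_trans _ _ ((u 0%N ^+ k.+1) ^+ 2)).
    by rewrite lerXn2r// nnegrE// exprn_ge0.
  by rewrite -exprM ler_wiXn2l// ?ltW//; lia.
have /andP[u0 u1] := u01 0%N.
have : (fun k => u 0%N ^+ k) @ \oo --> (0 : R) by apply: cvg_expr; rewrite ger0_norm.
move/cvgrPdist_lt => /(_ e e0) [N _ HN]; exists N.
have := HN N.+1 (leqnSn _); rewrite sub0r normrN ger0_norm ?exprn_ge0//.
exact: le_lt_trans.
Qed.

(* The factor x^2 produced by differentiating the exponent is absorbed by halving a. *)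
Lemma gauss_lipschitz {a s t : R} (x : R) : 0 < a -> a <= s -> s <= t ->
  gauss s x <= gauss t x + (t - s) * (2 / a) * gauss (a / 2) x.
Proof.
move=> a0 as_ st; rewrite /gauss; set u := pi * x ^+ 2.
have u0 : 0 <= u by rewrite mulr_ge0// ?pi_ge0// sqr_ge0.
have arg r : - pi * r * x ^+ 2 = - (r * u) by rewrite /u; ring.
rewrite !arg -lerBlDl.
have -> : - (t * u) = - (s * u) + - ((t - s) * u) by ring.
rewrite expRD -[X in X - _]mulr1 -mulrBr.
have h1 : 1 - expR (- ((t - s) * u)) <= (t - s) * u.
  by have := expR_ge1Dx (- ((t - s) * u)); lra.
have ts0 : 0 <= (t - s) * u by rewrite mulr_ge0// subr_ge0.
apply: (@le_trans _ _ (expR (- (a * u)) * ((t - s) * u))).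
  apply: (@le_trans _ _ (expR (- (s * u)) * ((t - s) * u))).
    by rewrite ler_wpM2l// expR_ge0.
  by rewrite ler_wpM2r// ler_expR lerN2 ler_wpM2r.
have -> : - (a * u) = - (a / 2 * u) + - (a / 2 * u) by field.
rewrite expRD; set E := expR (- (a / 2 * u)).
have E0 : 0 <= E by exact: expR_ge0.
have Eu : E * u <= 2 / a.
  rewrite /E expRN mulrC ler_pdivrMr ?expR_gt0//.
  have h := expR_ge1Dx (a / 2 * u).
  apply: (@le_trans _ _ (2 / a * (a / 2 * u))).
    by rewrite le_eqVlt; apply/orP; left; apply/eqP; field; rewrite gt_eqF.
  by rewrite ler_wpM2l// ?divr_ge0 ?ltW//; lra.
have -> : E * E * ((t - s) * u) = (t - s) * E * (E * u) by ring.
have -> : (t - s) * (2 / a) * E = (t - s) * E * (2 / a) by ring.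
by rewrite ler_wpM2l// mulr_ge0// subr_ge0.
Qed.

(** Summing [gauss_lipschitz] over the shifted integers gives a constant depending only on the lower
    bound [a]; monotonicity in tau removes the absolute value. *)
Lemma shifted_theta_lipschitz (c a s t : R) :
  (forall tau, 0 < tau ->
    has_sum [set: int] (fun m => gauss tau (m%:~R + c)) (shifted_theta c tau)) ->
  0 < a -> a <= s -> a <= t ->
  `|shifted_theta c s - shifted_theta c t| <= 2 / a * shifted_theta c (a / 2) * `|s - t|.
Proof.
move=> hc a0; wlog st : s t / s <= t => [wl as_ at_|as_ at_].
  by case: (leP s t) => [/wl|/ltW /wl h]; [exact|rewrite distrC [`|s - t|]distrC; exact: h].
have s0 := lt_le_trans a0 as_; have t0 := lt_le_trans a0 at_.
have mono : shifted_theta c t <= shifted_theta c s.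
  apply: has_sum_le (hc _ t0) (hc _ s0) => m _.
  rewrite /gauss ler_expR !mulNr lerN2 ler_wpM2r ?sqr_ge0//.
  by rewrite ler_wpM2l// pi_ge0.
have k0 : 0 <= (t - s) * (2 / a) by rewrite mulr_ge0 ?subr_ge0// divr_ge0// ltW.
have a2 : 0 < a / 2 by rewrite divr_gt0.
have G := has_sumZ k0 (fun m => gauss_ge0 _ _) (hc _ a2).
have H := has_sumD (fun m => gauss_ge0 _ _) (fun m => mulr_ge0 k0 (gauss_ge0 _ _)) (hc _ t0) G.
have := has_sum_le (fun m _ => gauss_lipschitz (m%:~R + c) a0 as_ st) (hc _ s0) H.
rewrite ger0_norm ?subr_ge0// ler0_norm ?subr_le0// => h.
by rewrite lerBlDl opprB [_ * (t - s)]mulrC mulrA.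
Qed.

Lemma shifted_theta_continuous (c x : R) :
  (forall tau, 0 < tau ->
    has_sum [set: int] (fun m => gauss tau (m%:~R + c)) (shifted_theta c tau)) ->
  0 < x -> {for x, continuous (shifted_theta c)}.
Proof.
move=> hc x0; have x2 : 0 < x / 2 by rewrite divr_gt0.
have x4 : 0 < x / 2 / 2 by rewrite divr_gt0.
set K := 2 / (x / 2) * shifted_theta c (x / 2 / 2).
have K0 : 0 <= K.
  apply: mulr_ge0; first by rewrite divr_ge0// ltW.
  exact: (has_sum_ge0 (fun m => gauss_ge0 _ _) (hc _ x4)).
apply/cvgrPdist_lt => e e0.
(* [K + 1] replaces [K] to have a positive divisor. *)
have eK : 0 < e / (K + 1) by rewrite divr_gt0// ltr_wpDl.
near=> y.
apply: (@le_lt_trans _ _ (K * `|x - y|)).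
  apply: shifted_theta_lipschitz => //; first lra.
  by apply/ltW; near: y; apply: lt_nbhsr; lra.
apply: (@le_lt_trans _ _ ((K + 1) * `|x - y|)); first by rewrite ler_wpM2r// lerDl.
rewrite mulrC -ltr_pdivlMr; last by rewrite ltr_wpDl.
by near: y; apply: cvgr_dist_lt; [exact: cvg_id|exact: eK].
Unshelve. all: end_near. Qed.

Lemma theta_ratio_continuous (x : R) : 0 < x -> {for x, continuous theta_ratio}.
Proof.
move=> x0; apply: cvgM; first by apply: shifted_theta_continuous => //; exact: @th2_sum.
apply: cvgV; first by rewrite gt_eqF// th3_gt0.
by apply: shifted_theta_continuous => //; exact: @th3_sum.
Qed.

Lemma theta_ratio_surj (r : R) : 0 < r < 1 -> exists2 tau, 0 < tau & theta_ratio tau = r.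
Proof.
move=> /andP[r0 r1].
have p k : (0 : R) < 2 ^+ k by rewrite exprn_gt0.
have q k : (0 : R) < 2 ^- k by rewrite invr_gt0.
have [k hk] : exists k : nat, theta_ratio (2 ^+ k) < r.
  apply: (@quadratic_decay (fun j => theta_ratio (2 ^+ j))) => // j.
    by have /andP[/ltW -> ->] := theta_ratio_itv (p j).
  have /andP[h0 h1] := theta_ratio_itv (p j).
  have /andP[g0 g1] := theta_ratio_itv (p j.+1).
  (* With r the ratio at 2^(j+1), the squared ratio at 2^j is 2 r / (1 + r^2), which is at least r
     since r < 1. *)
  have := theta_ratio_double (p j); rewrite -exprS; nra.
have [l hl] : exists l : nat, 1 - theta_ratio (2 ^- l) < 1 - r.
  apply: (@quadratic_decay (fun j => 1 - theta_ratio (2 ^- j))) => [j|j|]; last by rewrite subr_gt0.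
    by have /andP[h0 h1] := theta_ratio_itv (q j); rewrite subr_ge0 ltW//= ltrBlDr ltrDl.
  have /andP[h0 h1] := theta_ratio_itv (q j).
  have /andP[g0 g1] := theta_ratio_itv (q j.+1).
  have := theta_ratio_double (q j.+1).
  rewrite (_ : 2 * 2 ^- j.+1 = 2 ^- j); last by rewrite exprS; field; rewrite gt_eqF.
  move: (theta_ratio _) (theta_ratio _) h0 h1 g0 g1 => x y h0 h1 g0 g1 h.
  (* Here x and y are the ratios at 2^-(j+1) and 2^-j. Hence 1 - x <= 1 - x^2 <= (1 - y)^2. *)
  have e : (1 - x ^+ 2) * (1 + y ^+ 2) = (1 - y) ^+ 2.
    by rewrite mulrBl mul1r h; ring.
  have x2 : 0 <= x - x ^+ 2 by nra.
  have : 0 <= (1 - x ^+ 2) * y ^+ 2 by rewrite mulr_ge0 ?sqr_ge0//; lra.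
  lra.
have lk : 2 ^- l <= 2 ^+ k :> R.
  by apply: (@le_trans _ _ 1); [rewrite invf_le1// exprn_ege1// ler1n|rewrite exprn_ege1// ler1n].
have [||c] := @IVT R theta_ratio _ _ r lk.
- apply: continuous_in_subspaceT => x; rewrite inE /= in_itv/= => /andP[lx _].
  by apply: theta_ratio_continuous; exact: lt_le_trans (q l) lx.
- rewrite ge_min le_max; apply/andP; split; apply/orP; [right|left]; first exact: ltW.
  lra.
by rewrite in_itv/= => /andP[lc _] <-; exists c => //; exact: lt_le_trans (q l) lc.
Qed.
End Nome.

(** * Theta series of the lattices *)

Section Tfun.
Context {R : realType}.
Implicit Types tau s : R.

(** Expanding (theta_3 - theta_2)^2 at 4 tau produces the right-hand sides of both duplication
    formulas. *)
Lemma tfunE {tau} : 0 < tau ->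
  tfun tau = (th3 (2 * tau) ^+ 2 - th2 (2 * tau) ^+ 2) / th3 tau ^+ 2.
Proof.
move=> t0; have sqB (a b : R) : (a - b) ^+ 2 = a ^+ 2 + b ^+ 2 - 2 * (a * b) by ring.
by rewrite /tfun theta3E// theta4E// sqB (th3_sqr t0) (th2_sqr t0).
Qed.

Lemma tfun_onep {tau} : 0 < tau -> 1 + tfun tau = 2 * (th3 (2 * tau) / th3 tau) ^+ 2.
Proof.
move=> t0; have A0 := th3_gt0 t0; have h := th3_double t0; rewrite tfunE//.
move: (th3 tau) (th3 (2 * tau)) (th2 (2 * tau)) A0 h => a c d a0 h.
have -> : d ^+ 2 = a ^+ 2 - c ^+ 2 by rewrite h; ring.
by field; rewrite gt_eqF.
Qed.

Lemma tfun_onem {tau} : 0 < tau -> 1 - tfun tau = 2 * (th2 (2 * tau) / th3 tau) ^+ 2.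
Proof.
move=> t0; have A0 := th3_gt0 t0; have h := th3_double t0; rewrite tfunE//.
move: (th3 tau) (th3 (2 * tau)) (th2 (2 * tau)) A0 h => a c d a0 h.
have -> : c ^+ 2 = a ^+ 2 - d ^+ 2 by rewrite h; ring.
by field; rewrite gt_eqF.
Qed.

Lemma tfun_itv {tau} : 0 < tau -> 0 < tfun tau < 1.
Proof.
move=> t0; have t2 : 0 < 2 * tau by rewrite mulr_gt0.
have A0 := th3_gt0 t0; have A2 := th3_gt0 t2; have B2 := th2_gt0 t2.
have AB := th2_lt_th3 t2.
apply/andP; split.
  by rewrite tfunE// divr_gt0// ?exprn_gt0// subr_gt0 ltrXn2r// ?nnegrE ltW.
by rewrite -subr_gt0 tfun_onem// mulr_gt0// exprn_gt0// divr_gt0.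
Qed.

Lemma th3_double_tfun {tau} : 0 < tau ->
  th3 (2 * tau) = th3 tau / Num.sqrt 2 * Num.sqrt (1 + tfun tau).
Proof.
move=> t0; have t2 : 0 < 2 * tau by rewrite mulr_gt0.
have A0 := th3_gt0 t0; have A2 := th3_gt0 t2.
rewrite tfun_onep// sqrtrM// sqrtr_sqr ger0_norm; last by rewrite divr_ge0 ?ltW.
by field; rewrite !gt_eqF// sqrtr_gt0.
Qed.

Lemma th2_double_tfun {tau} : 0 < tau ->
  th2 (2 * tau) = th3 tau / Num.sqrt 2 * Num.sqrt (1 - tfun tau).
Proof.
move=> t0; have t2 : 0 < 2 * tau by rewrite mulr_gt0.
have A0 := th3_gt0 t0; have B2 := th2_gt0 t2.
rewrite tfun_onem// sqrtrM// sqrtr_sqr ger0_norm; last by rewrite divr_ge0 ?ltW.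
by field; rewrite !gt_eqF// sqrtr_gt0.
Qed.

(** The squared ratio at 2 tau equals (1 - t) / (1 + t) at tau, so t takes the value s where the
    ratio at 2 tau is the square root of (1 - s) / (1 + s). *)
Lemma tfun_surj s : 0 < s < 1 -> exists2 tau, 0 < tau & tfun tau = s.
Proof.
move=> /andP[s0 s1].
have p0 : 0 < (1 - s) / (1 + s) by rewrite divr_gt0; lra.
have p1 : (1 - s) / (1 + s) < 1 by rewrite ltr_pdivrMr; lra.
have [|tau t0 ht] := @theta_ratio_surj R (Num.sqrt ((1 - s) / (1 + s))).
  by rewrite sqrtr_gt0 p0/= -[ltRHS]sqrtr1 ltr_sqrt.
have t2 : 0 < tau / 2 by rewrite divr_gt0.
exists (tau / 2) => //; rewrite tfunE// [th3 (tau / 2) ^+ 2]th3_double//.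
have e : 2 * (tau / 2) = tau by field.
rewrite !e; move: (th3_gt0 t0) (congr1 (fun x => x ^+ 2) ht); rewrite /theta_ratio.
rewrite sqr_sqrtr ?ltW// expr_div_n => A0 h.
have hB : th2 tau ^+ 2 = (1 - s) / (1 + s) * th3 tau ^+ 2.
  by rewrite -h divfK// expf_neq0// gt_eqF.
rewrite hB; field; rewrite gt_eqF; [rewrite gt_eqF//|]; nra.
Qed.

End Tfun.

(** * Sums over integer vectors and the weight enumerator *)

Definition cons_row {T : Type} {n} (av : T * 'rV[T]_n) : 'rV[T]_n.+1 :=
  \row_i (if unlift ord0 i is Some j then av.2 0 j else av.1).

Lemma cons_row0 {T : Type} {n} (av : T * 'rV[T]_n) : cons_row av 0 ord0 = av.1.
Proof. by rewrite mxE unlift_none. Qed.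

Lemma cons_rowS {T : Type} {n} (av : T * 'rV[T]_n) j : cons_row av 0 (lift ord0 j) = av.2 0 j.
Proof. by rewrite mxE liftK. Qed.

(** Induction on n, splitting off the first coordinate by [cons_row]; for n = 0 there is one empty
    row, with empty product 1. *)
Lemma has_sum_prod {R : realType} {n} (f : 'I_n -> int -> R) (x : 'I_n -> R) :
  (forall i m, 0 <= f i m) -> (forall i, has_sum [set: int] (f i) (x i)) ->
  has_sum [set: 'rV[int]_n] (fun z => \prod_i f i (z 0 i)) (\prod_i x i).
Proof.
elim: n f x => [|n IH] f x f0 fx.
  rewrite (_ : [set: 'rV[int]_0] = [set 0]); last first.
    by apply/seteqP; split=> // z _; apply/rowP => -[].
  rewrite big_ord0.
  have := @has_sum_set1 R _ (0 : 'rV[int]_0) (fun z => \prod_i f i (z 0 i)).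
  by rewrite big_ord0; apply.
apply: (has_sum_reindex (P := [set: int] `*` [set: 'rV[int]_n]) cons_row).
  split=> //.
  - move=> [a v] [b w] _ _ /rowP h; congr (_, _).
      by have := h ord0; rewrite !cons_row0.
    by apply/rowP => j; have := h (lift ord0 j); rewrite !cons_rowS.
  - move=> z _; exists (z 0 ord0, \row_j z 0 (lift ord0 j)) => //.
    apply/rowP => i; case: (unliftP ord0 i) => [j|] ->.
      by rewrite cons_rowS mxE.
    by rewrite cons_row0.
rewrite big_ord_recl.
have pf0 (z : 'rV[int]_n) : 0 <= \prod_i f (lift ord0 i) (z 0 i) by exact: prodr_ge0.
have := IH (fun i => f (lift ord0 i)) (fun i => x (lift ord0 i)) (fun i => f0 _) (fun i => fx _).
move=> h; have := has_sum_setX (f0 ord0) pf0 (has_sum_ge0 pf0 h) (fx ord0) h.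
apply: has_sum_eq => -[a v] _ /=.
rewrite big_ord_recl cons_row0; congr (_ * _); apply: eq_bigr => i _.
by rewrite cons_rowS.
Qed.

Lemma F2_ltn (a : 'F_2) : (nat_of_ord a < 2)%N.
Proof. exact: ltn_ord. Qed.

Lemma F2_nat (a : 'F_2) : nat_of_ord a = (a != 0) :> nat.
Proof. by case: a => -[|[|k]] /= h. Qed.

Lemma gauss_lattice {R : realType} {n} (tau : R) (v : 'rV[R]_n) :
  expR (- pi * tau * sqnorm v) = \prod_i gauss tau (v 0 i).
Proof. by rewrite /sqnorm mulr_sumr expR_sum. Qed.

Lemma has_sum_Zn {R : realType} {n} {tau : R} : 0 < tau ->
  has_sum (@scaledZn R n 1) (fun v => expR (- pi * tau * sqnorm v)) (th3 tau ^+ n).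
Proof.
move=> t0; apply: (has_sum_reindex (P := [set: 'rV[int]_n]) (@intvec R n)).
  split=> [z _|z z' _ _ /rowP h|v [z ->]] /=; first by exists z; rewrite scale1r.
    by apply/rowP => i; have := h i; rewrite !mxE => /intr_inj.
  by exists z => //; rewrite scale1r.
have := has_sum_prod _ _ (fun (i : 'I_n) m => gauss_ge0 tau (m%:~R + 0)) (fun i => th3_sum t0).
rewrite prodr_const card_ord; apply: has_sum_eq => z _ /=; rewrite gauss_lattice.
by apply: eq_bigr => i _; rewrite mxE addr0.
Qed.

Lemma hwtE {n} (c : 'rV['F_2]_n) : hwt c = #|[set i | c 0 i != 0]%SET|.
Proof.
apply: eq_card => i; rewrite finset.inE; apply/idP/idP => [/set_mem//|h].
exact/mem_set.
Qed.

(** Grouping codewords by weight w makes each product x^(n-w) y^w. The left side is the form that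
    coordinatewise factorisation produces. *)
Lemma weight_enumE {R : realType} {n} (C : {set 'rV['F_2]_n}) (x y : R) :
  \sum_(c in C) \prod_i (if c 0 i == 0 then x else y) = weight_enum C x y.
Proof.
have hw (c : 'rV['F_2]_n) : (hwt c < n.+1)%N.
  by rewrite ltnS -[leqRHS]card_ord /hwt max_card.
rewrite (partition_big (fun c => Ordinal (hw c)) xpredT)//=; apply: eq_bigr => w _.
rewrite /wdist -sum1_card natr_sum !mulr_suml.
rewrite [RHS](eq_bigl (fun c => (c \in C) && (Ordinal (hw c) == w))); last first.
  by move=> c; rewrite inE.
apply: eq_bigr => c /andP[_ /eqP <-] /=.
rewrite mul1r (bigID (fun i => c 0 i == 0))/=.
rewrite (eq_bigr (fun=> x)); last by move=> i ->.
rewrite [X in _ * X](eq_bigr (fun=> y)); last by move=> i /negbTE ->.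
rewrite !prodr_const; congr (_ ^+ _ * _ ^+ _); last by rewrite hwtE cardsE.
transitivity #|(~: [set i | c 0 i != 0])%SET|; last first.
  have := cardsC [set i | c 0 i != 0]%SET; rewrite card_ord -hwtE => h.
  by apply/eqP; rewrite -(eqn_add2l (hwt c)) h subnKC// -ltnS.
transitivity #|[set i | c 0 i == 0]%SET|; first by rewrite cardsE.
by congr #|pred_of_set _|; apply/setP => i; rewrite !inE negbK.
Qed.

(** The lattice is the disjoint union of the scaled cosets of 2 Z^n, one per codeword. Each coset
    sum is a product over coordinates, with factor theta_3 or theta_2 at 2 tau as the codeword entry
    is 0 or 1. *)
Lemma has_sum_constructionA {R : realType} {n} (C : {set 'rV['F_2]_n}) {tau : R} : 0 < tau ->
  has_sum (@constructionA R n C) (fun v => expR (- pi * tau * sqnorm v))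
    (weight_enum C (th3 (2 * tau)) (th2 (2 * tau))).
Proof.
move=> t0; have t2 : 0 < 2 * tau by rewrite mulr_gt0.
rewrite -weight_enumE.
pose F c : set 'rV[R]_n := [set v | exists z : 'rV[int]_n,
  v = (Num.sqrt 2)^-1 *: (@phi R n c + 2 *: intvec R z)].
rewrite (_ : @constructionA R n C = [set v | exists2 c, c \in C & F c v]); last first.
  by apply/seteqP; split=> v /= [c]; [case=> cC hv; exists c|move=> cC hv; exists c].
have s2 : (Num.sqrt 2 : R)^-1 != 0 by rewrite invr_neq0// gt_eqF// sqrtr_gt0.
(* Cleared of the scaling, equal vectors have equal integer entries: their parities give c = c', and
   then z = z'. *)
have entry c c' z z' i :
    (Num.sqrt 2)^-1 *: (@phi R n c + 2 *: intvec R z) =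
    (Num.sqrt 2)^-1 *: (@phi R n c' + 2 *: intvec R z') ->
    (c 0 i)%:Z + 2 * z 0 i = (c' 0 i)%:Z + 2 * z' 0 i.
  move=> /(scalerI s2) /rowP /(_ i); rewrite !mxE => h.
  by apply: (@intr_inj R); rewrite !intrD !intrM.
apply: has_sum_bigU => [v|c c' v [z ->] [z' hz]|c cC]; first exact: expR_ge0.
  apply/rowP => i; have := entry _ _ _ _ i hz.
  have := F2_ltn (c 0 i); have := F2_ltn (c' 0 i).
  by move=> h h' e; apply: ord_inj; move: (c 0 i) (c' 0 i) h h' e => a b; lia.
apply: (has_sum_reindex (P := [set: 'rV[int]_n])
  (fun z => (Num.sqrt 2)^-1 *: (@phi R n c + 2 *: intvec R z))).
  split=> [z _|z z' _ _ hz|v [z ->]]; [by exists z| |by exists z].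
  by apply/rowP => i; have /addrI/mulfI := entry _ _ _ _ i hz; apply.
have h (i : 'I_n) : has_sum [set: int]
    (fun m => gauss (2 * tau) (m%:~R + (if c 0 i == 0 then 0 else 2^-1)))
    (if c 0 i == 0 then th3 (2 * tau) else th2 (2 * tau)).
  by case: ifP => _; [exact: th3_sum|exact: th2_sum].
have := has_sum_prod _ _ (fun i m => gauss_ge0 _ _) h.
apply: has_sum_eq => z _ /=; rewrite gauss_lattice; apply: eq_bigr => i _.
(* The exponents agree because (c + 2 z)^2 / 2 = 2 (z + c / 2)^2. *)
rewrite !mxE /gauss; congr expR; rewrite F2_nat exprMn exprVn sqr_sqrtr//.
by case: (c 0 i == 0) => /=; field.
Qed.

(** * Volume of the Construction A lattice *)

Lemma F2_eq1 (a : 'F_2) : a != 0 -> a = 1.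
Proof. by case: a => -[|[|k]] h // _; apply: val_inj. Qed.

(** All codewords together serve as rows. Closure under addition suffices, since 1 is the only
    nonzero scalar of F_2. *)
Lemma linear_code_mx {n} {C : {set 'rV['F_2]_n}} : is_linear_code C ->
  exists A : 'M['F_2]_(#|C|, n), forall v, (v \in C) = (v <= A)%MS.
Proof.
move=> [C0 CD]; exists (\matrix_(i < #|C|) enum_val i) => v.
apply/idP/idP => [vC|/submxP[u ->]].
  by rewrite -(enum_rankK_in C0 vC) -(rowK (fun i => enum_val i)) row_sub.
rewrite mulmx_sum_row; elim/big_ind: _ => // i _; rewrite rowK.
have [->|/F2_eq1 ->] := eqVneq (u 0 i) 0; first by rewrite scale0r.
by rewrite scale1r enum_valP.
Qed.

Lemma card_wdist {n} (C : {set 'rV['F_2]_n}) : #|C| = (\sum_(w < n.+1) wdist C w)%N.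
Proof.
have hw (c : 'rV['F_2]_n) : (hwt c < n.+1)%N.
  by rewrite ltnS -[leqRHS]card_ord /hwt max_card.
rewrite -sum1_card (partition_big (fun c => Ordinal (hw c)) xpredT)//=.
apply: eq_bigr => w _; rewrite /wdist -sum1_card; apply: eq_bigl => c.
by rewrite finset.inE.
Qed.

(** The dual code is the kernel of the transpose of [A]. *)
Lemma card_dual_code {n m} {C : {set 'rV['F_2]_n}} {A : 'M['F_2]_(m, n)} :
  (forall v, (v \in C) = (v <= A)%MS) -> #|dual_code C| = (2 ^ (n - \rank A))%N.
Proof.
move=> CA; transitivity #|rowg (kermx A^T)|; last first.
  by rewrite card_rowg mxrank_ker mxrank_tr card_Fp.
apply: eq_card => y.
have dot (x : 'rV['F_2]_n) : \sum_i x 0 i * y 0 i = (y *m x^T) 0 0.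
  by rewrite mxE; apply: eq_bigr => i _; rewrite mxE mulrC.
rewrite finset.inE mem_rowg; apply/forall_inP/sub_kermxP => [h|h x].
  apply/rowP => i; have /h : row i A \in C by rewrite CA row_sub.
  rewrite dot => /eqP; rewrite !mxE => e; rewrite -[RHS]e.
  by apply: eq_bigr => j _; rewrite !mxE.
rewrite CA => /submxP[u ->]; rewrite dot trmx_mul mulmxA h mul0mx mxE.
by rewrite eqxx.
Qed.

(** Equal weight distributions force equal cardinalities, that is 2^r = 2^(n-r) for r the rank of
    [A]. *)
Lemma formally_self_dual_rank {n m} {C : {set 'rV['F_2]_n}} {A : 'M['F_2]_(m, n)} :
  (forall v, (v \in C) = (v <= A)%MS) -> formally_self_dual C -> n = (\rank A + \rank A)%N.
Proof.
move=> CA fsd.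
have cC : #|C| = (2 ^ \rank A)%N.
  transitivity #|rowg A|; last by rewrite card_rowg card_Fp.
  by apply: eq_card => y; rewrite CA mem_rowg.
have : #|C| = #|dual_code C|.
  by rewrite !card_wdist; apply: eq_bigr => w _; rewrite fsd.
rewrite cC (card_dual_code CA) => /eqP; rewrite eqn_exp2l// => /eqP {1}->.
by rewrite subnK// rank_leq_col.
Qed.

(** The first [\rank A] rows of [row_ebase A] are a basis of the row space, and the inverse reads
    off coordinates. Over F_2, vanishing of the remaining coordinates becomes evenness after lifting
    to the integers. *)
Lemma submx_ebase {n m} {F : fieldType} {A : 'M[F]_(m, n)} (v : 'rV[F]_n) :
  (v <= A)%MS <-> forall j : 'I_n, (\rank A <= j)%N -> (v *m invmx (row_ebase A)) 0 j = 0.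
Proof.
have Eu := row_ebase_unit A.
rewrite -(eq_row_base A); split=> [/submxP[u ->] j rj|h].
  rewrite /row_base mulmxA mulmxK// mxE big1// => k _.
  rewrite mxE; case: eqP => /= [e|_]; last by rewrite mulr0.
  by have := ltn_ord k; rewrite e ltnNge rj.
rewrite -(mulmxKV Eu v); set w := v *m _.
suff -> : w = w *m @pid_mx F n (\rank A) (\rank A) *m @pid_mx F (\rank A) n (\rank A).
  by apply/submxP; exists (w *m @pid_mx F n (\rank A) (\rank A)); rewrite /row_base mulmxA.
rewrite -mulmxA pid_mx_id//; apply/rowP => j.
rewrite [RHS]mxE (bigD1 j)//= big1 ?addr0 => [|k kj]; rewrite [pid_mx _ _ _]mxE; last first.
  have kj' : (k == j :> nat) = false by apply/negbTE.
  by rewrite kj' mulr0.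
rewrite eqxx /=; case: ltnP => [_|rj]; first by rewrite mulr1.
by rewrite mulr0 h.
Qed.

Definition lift_F2 {m n} (A : 'M['F_2]_(m, n)) : 'M[int]_(m, n) :=
  map_mx (fun a => (nat_of_ord a)%:Z) A.

Lemma lift_F2K {m n} (A : 'M['F_2]_(m, n)) : map_mx intr (lift_F2 A) = A.
Proof. by apply/matrixP => i j; rewrite !mxE -pmulrn natr_Zp. Qed.

(* The triangular factors of an LUP decomposition over F_2 have unit diagonals, so they lift. *)
Lemma lift_unitmx {n} (E : 'M['F_2]_n) : E \in unitmx ->
  exists2 M : 'M[int]_n, map_mx intr M = E & `|\det M| = 1.
Proof.
case: n E => [|n] E uE.
  by exists 1%:M; [apply/matrixP => -[]|rewrite det1 normr1].
have := cormen_lup_correct E; have := cormen_lup_perm E.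
have := cormen_lup_lower E; have := cormen_lup_upper E.
case: (cormen_lup E) => -[P L] U /= Uu Ll /is_perm_mxP[s ->] PE.
have Elu : E = perm_mx s^-1%g *m L *m U.
  by rewrite -mulmxA -[L *m U]PE mulmxA -perm_mxM mulVg perm_mx1 mul1mx.
have : \det U != 0.
  by move: uE; rewrite Elu unitmxE !det_mulmx unitfE mulf_eq0 negb_or => /andP[].
rewrite -det_tr det_trig; last first.
  by apply/is_trig_mxP => i j ij; rewrite mxE Uu.
move/prodf_neq0 => Ud.
exists (perm_mx s^-1%g *m lift_F2 L *m lift_F2 U).
  by rewrite !map_mxM/= map_perm_mx !lift_F2K.
rewrite !det_mulmx det_perm -[\det (lift_F2 U)]det_tr !det_trig.
- rewrite big1 => [|i _]; last by rewrite mxE Ll// eqxx.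
  rewrite big1 => [|i _]; first by rewrite !mulr1 normrX normrN normr1 expr1n.
  by rewrite !mxE (F2_eq1 (U i i))//; have := Ud i isT; rewrite mxE.
- by apply/is_trig_mxP => i j ij; rewrite !mxE Uu.
- by apply/is_trig_mxP => i j ij; rewrite !mxE (Ll _ _ (ltnW ij)) -val_eqE /= (ltn_eqF ij).
Qed.

Lemma F2_dvd (a : int) : (a%:~R == 0 :> 'F_2) = (2 %| a)%Z.
Proof. by rewrite -(dvdz_pcharf (pchar_Fp (isT : prime 2))). Qed.

(** The unscaled Construction A lattice is the preimage of the code under reduction modulo 2. *)
Lemma code_lift {n} (C : {set 'rV['F_2]_n}) (x : 'rV[int]_n) :
  map_mx intr x \in C <->
  exists2 c, c \in C & exists z : 'rV[int]_n, x = lift_F2 c + 2 *: z.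
Proof.
split=> [xC|[c cC [z ->]]].
  exists (map_mx intr x) => //.
  exists (\row_i divz (x 0 i - (lift_F2 (map_mx intr x) : 'rV_n) 0 i) 2).
  apply/rowP => i; rewrite !mxE [2 * _]mulrC divzK ?subrKC//.
  by rewrite -F2_dvd intrB -pmulrn natr_Zp subrr.
suff -> : map_mx intr (lift_F2 c + 2 *: z) = c by [].
rewrite -[RHS]lift_F2K; apply/rowP => i; rewrite !mxE intrD intrM.
by rewrite (_ : (2 : int)%:~R = 0 :> 'F_2) ?mul0r ?addr0//; apply/val_inj.
Qed.

(** An explicit generator matrix of that preimage: lift [row_ebase A] to a unimodular M, and double
    the rows of M from index [\rank A] on. *)
Lemma code_lift_unimodular {n m} {C : {set 'rV['F_2]_n}} {A : 'M['F_2]_(m, n)} :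
  (forall v, (v \in C) = (v <= A)%MS) ->
  exists2 M : 'M[int]_n, `|\det M| = 1 & forall x : 'rV[int]_n, map_mx intr x \in C <->
    exists z : 'rV[int]_n,
      x = z *m (diag_mx (\row_j (if (j < \rank A)%N then 1 else 2)) *m M).
Proof.
move=> CA; have Eu := row_ebase_unit A.
have [M ME detM] := lift_unitmx _ Eu; exists M => // x.
have uM : M \in unitmx.
  rewrite unitmxE; apply/unitrP; exists (\det M).
  by move/eqP: detM; rewrite eqr_norml => /andP[/orP[]/eqP-> _].
have E x' : map_mx intr (x' *m invmx M) = map_mx intr x' *m invmx (row_ebase A) :> 'rV['F_2]_n.
  by rewrite -[LHS](mulmxK Eu) -{1}ME -map_mxM mulmxKV.
rewrite CA submx_ebase -E; split=> [h|[z ->] j rj].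
  exists (\row_j (if (j < \rank A)%N then (x *m invmx M) 0 j else divz ((x *m invmx M) 0 j) 2)).
  rewrite mulmxA -[LHS](mulmxKV uM); congr (_ *m _); apply/rowP => j.
  have hj := h j; rewrite mxE in hj.
  rewrite mul_mx_diag [RHS]mxE [X in X * _]mxE [X in _ * X]mxE.
  move: hj; case: ltnP => rj; first by rewrite mulr1.
  by move=> /(_ isT)/eqP; rewrite F2_dvd => d; rewrite divzK.
rewrite mulmxA mulmxK// mul_mx_diag !mxE ltnNge rj /=.
by rewrite intrM (_ : (2 : int)%:~R = 0 :> 'F_2) ?mulr0//; apply/val_inj.
Qed.

Lemma prod_threshold {R : comPzRingType} (n r : nat) (a : R) : (r <= n)%N ->
  \prod_(j < n) (if (j < r)%N then 1 else a) = a ^+ (n - r).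
Proof.
move=> rn; rewrite -(big_mkord xpredT (fun j => if (j < r)%N then 1 else a)).
rewrite (big_cat_nat _ rn)//= big1_seq ?mul1r; last first.
  by move=> j /=; rewrite mem_index_iota => /andP[_ ->].
rewrite (eq_big_nat _ _ (F2 := fun=> a)) ?prodr_const_nat// => j /andP[rj _].
by rewrite ltnNge rj.
Qed.

(** * Determinants of generator matrices *)

Section Volume.
Context {R : realType}.

Lemma intvecM {n} (z : 'rV[int]_n) (N : 'M[int]_n) :
  intvec R (z *m N) = intvec R z *m map_mx intr N.
Proof. by rewrite /intvec map_mxM. Qed.

Lemma generator_matrix_sub {n} (B B' : 'M[R]_n) (L : set 'rV[R]_n) :
  generator_matrix B L -> generator_matrix B' L ->
  exists N : 'M[int]_n, B = map_mx intr N *m B'.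
Proof.
move=> [_ LB] [_ LB'].
have rowB i : exists z : 'rV[int]_n, row i B = intvec R z *m B'.
  have : L (row i B).
    rewrite LB /=; exists (delta_mx 0 i); rewrite /intvec rowE; congr (_ *m _).
    by apply/rowP => j; rewrite !mxE; case: (_ && _).
  by rewrite LB'.
have [f hf] := choice rowB; exists (\matrix_(i, j) f i 0 j).
apply/row_matrixP => i; rewrite hf row_mul; congr (_ *m _).
by apply/rowP => j; rewrite !mxE.
Qed.

(** Two generator matrices differ by integer matrices both ways; the determinants of these multiply
    to 1, so each is 1 or -1. *)
Lemma generator_matrix_det {n} (B B' : 'M[R]_n) (L : set 'rV[R]_n) :
  generator_matrix B L -> generator_matrix B' L -> `|\det B| = `|\det B'|.
Proof.
move=> gB gB'.
have [N hN] := generator_matrix_sub _ _ _ gB gB'.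
have [N' hN'] := generator_matrix_sub _ _ _ gB' gB.
have dB : \det B != 0 by have [] := gB; rewrite unitmxE unitfE.
have e : \det B = (\det N)%:~R * \det B' by rewrite {1}hN det_mulmx det_map_mx.
have e' : \det B' = (\det N')%:~R * \det B by rewrite {1}hN' det_mulmx det_map_mx.
have : (\det N * \det N')%:~R = 1 :> R.
  by apply: (mulIf dB); rewrite intrM mul1r -mulrA -e' -e.
rewrite -[1]/(1%:~R) => /intr_inj h.
have {h} : `|\det N| = 1.
  have /eqP := congr1 absz h; rewrite abszM muln_eq1 => /andP[/eqP hdet _].
  by rewrite -abszE hdet.
by rewrite e normrM -intr_norm => ->; rewrite mul1r.
Qed.

Lemma lattice_volumeE {n} (B : 'M[R]_n) (L : set 'rV[R]_n) :
  generator_matrix B L -> lattice_volume L = `|\det B|.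
Proof.
move=> gB; apply: xget_unique; first by exists B.
by move=> _ [B' [gB' ->]]; exact: generator_matrix_det gB' gB.
Qed.

Lemma lattice_volume_constructionA {n} (C : {set 'rV['F_2]_n}) :
  is_linear_code C -> formally_self_dual C -> lattice_volume (@constructionA R n C) = 1.
Proof.
move=> /linear_code_mx[A CA] fsd.
have nr := formally_self_dual_rank CA fsd; have [M detM hM] := code_lift_unimodular CA.
set D := diag_mx _ in hM.
have s2 : Num.sqrt 2 != 0 :> R by rewrite gt_eqF// sqrtr_gt0.
(* The diagonal has n - r entries equal to 2, and n = 2 r. The scaling contributes the inverse of
   sqrt(2)^n = 2^r, which cancels this. *)
have dD : \det D = 2 ^+ \rank A.
  rewrite det_diag (eq_bigr (fun j : 'I_n => if (j < \rank A)%N then 1 else 2)).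
    by rewrite prod_threshold ?rank_leq_col// {1}nr addnK.
  by move=> j _; rewrite mxE.
pose B := (Num.sqrt 2)^-1 *: map_mx intr (D *m M) : 'M[R]_n.
have dB : `|\det B| = 1.
  rewrite /B detZ det_map_mx/= det_mulmx dD intrM normrM normrM.
  rewrite [`|(\det M)%:~R|](_ : _ = 1); last by rewrite -intr_norm detM.
  rewrite (_ : _ ^+ n = (Num.sqrt 2)^-1 ^+ (\rank A + \rank A)); last by congr (_ ^+ _).
  rewrite mulr1 exprD -exprMn -expr2 exprVn sqr_sqrtr//.
  rewrite -normrM rmorphXn/= -exprMn mulVf// expr1n normr1//.
rewrite -dB; apply: lattice_volumeE; split.
  by rewrite unitmxE unitfE -normr_eq0 dB oner_eq0.
have eB z : intvec R z *m B = (Num.sqrt 2)^-1 *: intvec R (z *m (D *m M)).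
  by rewrite /B -scalemxAr intvecM.
have eC c z : @phi R n c + 2 *: intvec R z = intvec R (lift_F2 c + 2 *: z).
  by apply/rowP => i; rewrite !mxE intrD intrM.
apply/seteqP; split=> v /=.
  move=> [c [cC [z ->]]]; rewrite eC.
  have [w ->] : exists w, lift_F2 c + 2 *: z = w *m (D *m M).
    by apply/hM/code_lift; exists c => //; exists z.
  by exists w; rewrite eB.
move=> [w ->]; rewrite eB.
have /code_lift[c cC [z ->]] : map_mx intr (w *m (D *m M)) \in C by apply/hM; exists w.
by exists c; split=> //; exists z; rewrite eC.
Qed.

End Volume.

(** * The secrecy function and the two optimisation problems *)

Lemma weight_enum_scale {R : realType} {n} (C : {set 'rV['F_2]_n}) (k x y : R) :
  weight_enum C (k * x) (k * y) = k ^+ n * weight_enum C x y.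
Proof.
rewrite /weight_enum mulr_sumr; apply: eq_bigr => w _.
have wn : (w <= n)%N by rewrite -ltnS.
have -> : k ^+ n = k ^+ (n - w) * k ^+ w by rewrite -exprD subnK.
by rewrite !exprMn; ring.
Qed.

(** The zero codeword makes the term w = 0 positive; the other terms are nonnegative. *)
Lemma fC_gt0 {R : realType} {n} (C : {set 'rV['F_2]_n}) (t : R) :
  0 \in C -> -1 < t < 1 -> 0 < fC C t.
Proof.
move=> C0 /andP[t0 t1]; rewrite /fC /weight_enum big_ord_recl.
have x0 : 0 < Num.sqrt (1 + t) by rewrite sqrtr_gt0 -ltrBlDl sub0r.
have y0 : 0 < Num.sqrt (1 - t) by rewrite sqrtr_gt0 subr_gt0.
apply: ltr_pwDl; last first.
  by apply: sumr_ge0 => i _; rewrite !mulr_ge0// exprn_ge0// ltW.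
rewrite !mulr_gt0// ?exprn_gt0// ltr0n card_gt0; apply/set0Pn.
exists 0; rewrite finset.inE C0 hwtE /= cards_eq0; apply/eqP/setP => i.
by rewrite !finset.inE mxE eqxx.
Qed.

(** With volume 1, the reciprocal is W_C(theta_3(2 tau), theta_2(2 tau)) / theta_3(tau)^n.
    Homogeneity extracts (theta_3(tau) / sqrt 2)^n from the numerator. *)
Lemma secrecyV {R : realType} {n} (C : {set 'rV['F_2]_n}) (tau : R) :
  is_linear_code C -> formally_self_dual C -> 0 < tau ->
  (secrecy (@constructionA R n C) tau)^-1 = fC C (tfun tau) / 2 `^ (n%:R / 2).
Proof.
move=> lC fC_ t0; rewrite /secrecy lattice_volume_constructionA// powR1 invf_div.
rewrite /theta_lattice (has_sum_constructionA C t0) (has_sum_Zn t0) /=.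
rewrite (th3_double_tfun t0) (th2_double_tfun t0) weight_enum_scale -/(fC C _).
have An0 : th3 tau ^+ n != 0 by rewrite expf_neq0// gt_eqF// th3_gt0.
have -> : 2 `^ (n%:R / 2) = Num.sqrt 2 ^+ n :> R.
  by rewrite mulrC powRrM powR12_sqrt// powR_mulrn// sqrtr_ge0.
have s0 : Num.sqrt 2 ^+ n != 0 :> R by rewrite expf_neq0// gt_eqF// sqrtr_gt0.
rewrite expr_div_n; field.
by rewrite An0 s0.
Qed.

Theorem theorem2 (R : realType) (n : nat) (C : {set 'rV['F_2]_n}) :
  is_linear_code C -> formally_self_dual C ->
  let L := @constructionA R n C in
  (forall tau : R, 0 < tau ->
     0 < tfun tau < 1 /\
     (secrecy L tau)^-1 = fC C (tfun tau) / 2 `^ (n%:R / 2)) /\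
  (forall tau0 : R, 0 < tau0 ->
     (forall tau : R, 0 < tau -> secrecy L tau <= secrecy L tau0) <->
     (forall s : R, 0 < s < 1 -> fC C (tfun tau0) <= fC C s)) /\
  ((exists2 tau0 : R, 0 < tau0 &
      forall tau : R, 0 < tau -> secrecy L tau <= secrecy L tau0) <->
   (exists2 s0 : R, 0 < s0 < 1 &
      forall s : R, 0 < s < 1 -> fC C s0 <= fC C s)).
Proof.
move=> lC sdC L.
have xiV tau : 0 < tau -> (secrecy L tau)^-1 = fC C (tfun tau) / 2 `^ (n%:R / 2).
  by move=> t0; exact: secrecyV.
have p0 : 0 < 2 `^ (n%:R / 2) :> R by rewrite powR_gt0.
have f0 tau : 0 < tau -> 0 < fC C (tfun tau).
  move=> /tfun_itv/andP[t0 t1]; apply: fC_gt0; first by case: lC.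
  by rewrite t1 andbT (lt_trans _ t0)// oppr_lt0.
(* Passing to reciprocals reverses the order, legitimately because [fC] is positive at both
   points. *)
have xi_le tau tau0 : 0 < tau -> 0 < tau0 ->
    (secrecy L tau <= secrecy L tau0) = (fC C (tfun tau0) <= fC C (tfun tau)).
  move=> t0 u0; rewrite -[secrecy L tau]invrK -[secrecy L tau0]invrK !xiV//.
  by rewrite lef_pV2 ?ler_pM2r ?invr_gt0// posrE divr_gt0// f0.
have max_iff tau0 : 0 < tau0 ->
    (forall tau : R, 0 < tau -> secrecy L tau <= secrecy L tau0) <->
    (forall s : R, 0 < s < 1 -> fC C (tfun tau0) <= fC C s).
  (* From maximum to minimum, surjectivity of t reaches every s in (0, 1); the converse only needs t
     to take values there. *)
  move=> u0; split=> [h s /tfun_surj[tau t0 <-]|h tau t0]; first by rewrite -xi_le ?h.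
  by rewrite xi_le// h// tfun_itv.
split; first by move=> tau t0; rewrite tfun_itv// xiV.
split=> //; split=> [[tau0 u0 /max_iff h]|[s0 /tfun_surj[tau0 u0 <-] h]].
  by exists (tfun tau0); [exact: tfun_itv|exact: h].
by exists tau0 => //; apply/max_iff.
Qed.
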